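(* Let $(X,d)$ and $(Y,d')$ be metric spaces and let $f:X\to Y$ be a continuous function. Let $\widetilde f:\mathrm{CL}(X)\to \mathrm{CL}(Y)$ be the induced function $\widetilde f(A)=\overline{f(A)}$, where $\mathrm{CL}(X)$ and $\mathrm{CL}(Y)$ are equipped with the Attouch-Wets metrics $d_{AW}$ and $d'_{AW}$, respectively. Then $\widetilde f$ is continuous if and only if the following two conditions hold: (1) $f$ is uniformly continuous on every subset $A$ of $X$ such that $f(A)$ is bounded. (2) The set $f^{-1}(B)$ is bounded for every bounded subset $B$ of $Y$ such that $|B\cap f(X)|>1$.
   Context: For a topological space $X$, $\mathrm{CL}(X)$ denotes the family of all nonempty closed subsets of $X$. For a metric space $(X,d)$, the Attouch-Wets metric on $\mathrm{CL}(X)$ based at a fixed point $x_0\in X$ is $$d_{AW}(A,B)=\sup_{j\in\mathbb N}\ \min\Big\{\tfrac1j,\ \sup_{d(x_0,x)<j}|d(x,A)-d(x,B)|\Big\},$$ where $\mathbb N=\{1,2,\dots\}$ and $d(x,A)=\inf_{a\in A}d(x,a)$; the topology it generates does not depend on the choice of $x_0$. A map $f:X\to Y$ between metric spaces is said to be uniformly continuous on the set $A\subset X$ if for every $\varepsilon>0$ there exists $\delta>0$ such that whenever $a\in A$, $x\in X$ (with $x$ not required to be in $A$) and $d(a,x)<\delta$, then $d'(f(a),f(x))<\varepsilon$. *)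

(* Defs.v *)
From HB Require Import structures.
From mathcomp Require Import all_boot all_order all_algebra.
From mathcomp Require Import all_classical all_reals all_analysis.

Set Implicit Arguments.
Unset Strict Implicit.
Unset Printing Implicit Defensive.

Import Order.TTheory GRing.Theory Num.Theory.

Local Open Scope classical_set_scope.
Local Open Scope ring_scope.

Record CL (X : topologicalType) := MkCL {
  cl_set :> set X ;
  cl_closed : closed cl_set ;
  cl_nonempty : cl_set !=set0 }.

Lemma CL_eq (X : topologicalType) (A B : CL X) : cl_set A = cl_set B -> A = B.
Proof.
case: A B => [A cA nA] [B cB nB] /= AB; case: _ / AB cB nB => cB nB.
by rewrite (Prop_irrelevance cA cB) (Prop_irrelevance nA nB).
Qed.

Section metric.
Context {R : realType}.

Definition dist_set {X : metricType R} (x : X) (A : set X) : R :=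
  inf [set mdist x a | a in A].

Definition metric_bounded {X : metricType R} (A : set X) : Prop :=
  exists M : R, forall x y, A x -> A y -> mdist x y <= M.

(* The second point ranges over all of X, so this is stronger than uniform
   continuity of the restriction of f to A. *)
Definition unif_continuous_on {X Y : metricType R} (f : X -> Y) (A : set X) :=
  forall eps : R, 0 < eps -> exists2 delta : R, 0 < delta &
    forall a x, A a -> mdist a x < delta -> mdist (f a) (f x) < eps.

(* For nonempty A and B both suprema are taken over nonempty bounded sets, so
   the totalized real sup is the usual one. *)
Definition aw_dist {X : metricType R} (x0 : X) (A B : set X) : R :=
  sup [set Num.min j%:R^-1
             (sup [set `|dist_set x A - dist_set x B|
                  | x in [set x | mdist x0 x < j%:R]])
      | j in [set j : nat | (0 < j)%N]].

End metric.

Section aw_dist_theory.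
Context {R : realType} {X : metricType R}.
Implicit Types (x y : X) (A B C : CL X).

Lemma dist_set_lb x (S : set X) : has_lbound [set mdist x a | a in S].
Proof. by exists 0 => _ [a _ <-]; exact: mdist_ge0. Qed.

Lemma dist_set_le x (S : set X) a : S a -> dist_set x S <= mdist x a.
Proof. by move=> Sa; apply: ge_inf; [exact: dist_set_lb|exists a]. Qed.

Lemma dist_set_ge0 x A : 0 <= dist_set x A.
Proof.
apply: lb_le_inf; first by case: (cl_nonempty A) => a Aa; exists (mdist x a), a.
by move=> _ [a _ <-]; exact: mdist_ge0.
Qed.

Lemma dist_set_lip x y A : dist_set x A <= mdist x y + dist_set y A.
Proof.
rewrite -lerBlDl; apply: lb_le_inf.
  by case: (cl_nonempty A) => a Aa; exists (mdist y a), a.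
move=> _ [a Aa <-]; rewrite lerBlDl.
exact: le_trans (dist_set_le x Aa) (metric_triangle _ _ _).
Qed.

Lemma dist_set_eq0 x A : dist_set x A = 0 -> cl_set A x.
Proof.
move=> d0; apply: (@cl_closed _ A x) => U.
rewrite -metricType_numDomainType.filter_from_mdist_nbhs => -[e /= e0 eU].
have [_ [a Aa <-]] : exists2 r, [set mdist x a | a in A] r &
    r < inf [set mdist x a | a in A] + e.
  apply: inf_adherent => //; split; last exact: dist_set_lb.
  by case: (cl_nonempty A) => a Aa; exists (mdist x a), a.
by rewrite -/(dist_set x A) d0 add0r => xa; exists a; split => //; apply: eU.
Qed.

Variable x0 : X.

Let gap A B (j : nat) := [set `|dist_set x A - dist_set x B|
                         | x in [set x | mdist x0 x < j%:R]].

Let gap_has_sup A B j : (0 < j)%N -> has_sup (gap A B j).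
Proof.
move=> j0; split.
  by exists `|dist_set x0 A - dist_set x0 B|, x0 => //=; rewrite mdistxx ltr0n.
exists ((j%:R + dist_set x0 A) + (j%:R + dist_set x0 B)) => _ [x /= xj <-].
rewrite (le_trans (ler_normB _ _))// !ger0_norm ?dist_set_ge0// lerD//;
  by rewrite (le_trans (dist_set_lip x x0 _))// lerD2r metric_sym ltW.
Qed.

Let gap_le A B (j : nat) x : (0 < j)%N -> mdist x0 x < j%:R ->
  `|dist_set x A - dist_set x B| <= sup (gap A B j).
Proof. by move=> j0 xj; apply: sup_upper_bound; [exact: gap_has_sup|exists x]. Qed.

Let gap_ge0 A B j : (0 < j)%N -> 0 <= sup (gap A B j).
Proof.
move=> j0; apply: le_trans (gap_le A B (x := x0) j0 _); first exact: normr_ge0.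
by rewrite mdistxx ltr0n.
Qed.

Lemma aw_dist_ge A B j : (0 < j)%N ->
  Num.min j%:R^-1 (sup (gap A B j)) <= aw_dist x0 A B.
Proof.
move=> j0; apply: ub_le_sup; last by exists j.
exists 1 => _ [k /= k0 <-]; rewrite ge_min invf_le1 ?ltr0n// ler1n k0.
by [].
Qed.

Lemma aw_dist_le A B r :
  (forall j, (0 < j)%N -> Num.min j%:R^-1 (sup (gap A B j)) <= r) ->
  aw_dist x0 A B <= r.
Proof.
move=> H; apply: ge_sup; first by exists (Num.min 1%:R^-1 (sup (gap A B 1))), 1%N.
by move=> _ [j /= j0 <-]; exact: H.
Qed.

Lemma aw_distxx A : aw_dist x0 A A = 0.
Proof.
apply/eqP; rewrite eq_le; apply/andP; split; last first.
  by apply: le_trans (aw_dist_ge A A (ltn0Sn 0)); rewrite le_min gap_ge0// invr1 ler01.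
apply: aw_dist_le => j j0; rewrite ge_min; apply/orP; right.
apply: ge_sup; first by have [] := gap_has_sup A A j0.
by move=> _ [x _ <-]; rewrite subrr normr0.
Qed.

Lemma aw_dist_positivity A B : aw_dist x0 A B = 0 -> A = B.
Proof.
move=> d0; have dE x : dist_set x A = dist_set x B.
  have [j jx] : exists j : nat, mdist x0 x < j.+1%:R.
    by exists (Num.truncn (mdist x0 x)); exact: truncnS_gt.
  have := aw_dist_ge A B (ltn0Sn j); rewrite d0 ge_min leNgt invr_gt0 ltr0n /=.
  move=> s0; apply/eqP; rewrite -subr_eq0 -normr_le0.
  exact: le_trans (gap_le A B (ltn0Sn j) jx) s0.
have self (D : CL X) x : cl_set D x -> dist_set x D = 0.
  move=> Dx; apply/eqP; rewrite eq_le dist_set_ge0 andbT.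
  by rewrite -(mdistxx x); exact: dist_set_le.
apply: CL_eq; apply/seteqP; split => x /self dx; apply: dist_set_eq0.
  by rewrite -dE.
by rewrite dE.
Qed.

Lemma aw_dist_sym A B : aw_dist x0 A B = aw_dist x0 B A.
Proof.
rewrite /aw_dist; congr (sup _); apply: eq_imagel => j _; congr (Num.min _ _).
by congr (sup _); apply: eq_imagel => x _; rewrite distrC.
Qed.

Lemma aw_dist_triangle B A C :
  aw_dist x0 A C <= aw_dist x0 A B + aw_dist x0 B C.
Proof.
apply: aw_dist_le => j j0.
apply: le_trans (lerD (aw_dist_ge A B j0) (aw_dist_ge B C j0)).
have jV : 0 <= j%:R^-1 :> R by rewrite invr_ge0.
have AB0 := gap_ge0 A B j0; have BC0 := gap_ge0 B C j0.
have : sup (gap A C j) <= sup (gap A B j) + sup (gap B C j).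
  apply: ge_sup; first by have [] := gap_has_sup A C j0.
  move=> _ [x /= xj <-]; apply: le_trans (lerD (gap_le A B j0 xj) (gap_le B C j0 xj)).
  exact: ler_distD.
move: AB0 BC0 jV; move: (j%:R^-1) (sup _) (sup _) (sup _) => v c b a a0 b0 v0 cab.
rewrite ge_min; case: (leP v a) => va; case: (leP v b) => vb; apply/orP.
- by left; rewrite lerDl.
- by left; rewrite lerDl.
- by left; rewrite lerDr.
- by right.
Qed.

End aw_dist_theory.

(* The base point is recorded in the type so that the metric, which depends on
   it, can be a canonical instance. *)
Definition AW {R : realType} {X : metricType R} (x0 : X) : Type := CL X.

HB.instance Definition _ (R : realType) (X : metricType R) (x0 : X) :=
  gen_eqMixin (AW x0).
HB.instance Definition _ (R : realType) (X : metricType R) (x0 : X) :=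
  gen_choiceMixin (AW x0).
HB.instance Definition _ (R : realType) (X : metricType R) (x0 : X) :=
  @isMetric.Build R (AW x0) (fun A B : CL X => aw_dist x0 A B)
    (aw_distxx x0) (@aw_dist_positivity _ _ x0) (aw_dist_sym x0)
    (aw_dist_triangle x0).

Lemma AW_mdistE (R : realType) (X : metricType R) (x0 : X) (A B : AW x0) :
  mdist A B = aw_dist x0 (A : CL X) (B : CL X).
Proof. by []. Qed.

Lemma closure_image_nonempty (X Y : topologicalType) (f : X -> Y) (A : CL X) :
  closure (f @` A) !=set0.
Proof. by have [a Aa] := cl_nonempty A; exists (f a); apply: subset_closure; exists a. Qed.

Definition CL_map {X Y : topologicalType} (f : X -> Y) (A : CL X) : CL Y :=
  MkCL (@closed_closure _ (f @` A)) (closure_image_nonempty f A).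

(* Main.v *)
(** Sufficiency: if f is not constant, (2) makes preimages of balls bounded, so
by (1) f is uniformly continuous on them; since only the points of f(A) and f(B)
near y0 matter on a ball, Attouch-Wets closeness of A and B passes to f(A), f(B).

Necessity: if f~ is continuous at the closure of S, then adding to S a point a
that is close to S or far from x0, and with f(a) in a fixed ball, forces f(a) to
be close to f(S).  For (1), a failure of uniform continuity gives
d(a_n, x_n) -> 0 with f(a_n), f(x_n) at least e apart; by Efremovich's lemma,
along a subsequence all the f(a_i) are at least e/4 from all the f(x_j), and
S = {x_j} is contradictory.  For (2), let f(u) and f(v) be distinct: taking
S = {u} and S = {v}, the points z of f^-1(B) far from x0 have f(z) close both to
f(u) and to f(v). *)

Require Import Defs.
From mathcomp Require Import all_boot all_order all_algebra.
From mathcomp Require Import all_classical all_reals all_analysis.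
From mathcomp Require Import lra.

Set Implicit Arguments.
Unset Strict Implicit.
Unset Printing Implicit Defensive.

Import Order.TTheory GRing.Theory Num.Theory.

Local Open Scope classical_set_scope.
Local Open Scope ring_scope.

(** * Pointwise criteria for cardinality, closure and continuity *)

Lemma card_le1P {T : Type} (S : set T) :
  (S #<= `I_1)%card <-> forall x y, S x -> S y -> x = y.
Proof.
split=> [/pcard_leP[g] x y Sx Sy|H].
  have inI z : S z -> g z = 0%N.
    by move=> Sz; have : `I_1 (g z) by [exact: funS]; rewrite /= ltnS leqn0 => /eqP.
  by apply: (@inj _ _ S g); rewrite ?inE//; exact: etrans (inI x Sx) (esym (inI y Sy)).
have [->|/eqP/set0P[x Sx]] := pselect (S = set0); first exact: card_ge0.
rewrite -(card_le_eqr (@card_set1 T x)); apply: subset_card_le => y Sy.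
exact: H.
Qed.

Lemma closure_mdistP {R : realType} {X : metricType R} (S : set X) (x : X) :
  closure S x <-> forall e : R, 0 < e -> exists2 a, S a & mdist x a < e.
Proof.
split=> [cSx e e0|H U].
  have /cSx[a [Sa xa]] : nbhs x [set y | mdist x y < e].
    by rewrite -metricType_numDomainType.filter_from_mdist_nbhs; exists e.
  by exists a.
rewrite -metricType_numDomainType.filter_from_mdist_nbhs => -[e /= /H[a Sa xa] eU].
by exists a; split => //; apply: eU.
Qed.

Lemma continuous_mdistP {R : realType} {X Y : metricType R} (f : X -> Y) :
  continuous f <-> forall x (e : R), 0 < e ->
    exists2 d, 0 < d & forall y, mdist x y < d -> mdist (f x) (f y) < e.
Proof.
split=> [fc x e e0|H x].
  have /(_ (nbhs_filter x)) := metricType_numDomainType.cvgr_dist_lt (fc x) e0.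
  by move=> /metricType_numDomainType.nbhs_mdistP[d d0 dP]; exists d.
apply/metricType_numDomainType.cvgrPdist_lt => e /(H x)[d d0 dP].
by apply/metricType_numDomainType.nbhs_mdistP; exists d.
Qed.

(** * Distances to arbitrary nonempty sets *)

Section dist_set.
Context {R : realType} {X : metricType R}.
Implicit Types (x : X) (S : set X).

Lemma dist_set_glb x S (r : R) : S !=set0 ->
  (forall a, S a -> r <= mdist x a) -> r <= dist_set x S.
Proof.
move=> [a Sa] rS; apply: lb_le_inf; first by exists (mdist x a), a.
by move=> _ [b Sb <-]; exact: rS.
Qed.

Lemma dist_set_lt x S (r : R) : S !=set0 -> dist_set x S < r ->
  exists2 a, S a & mdist x a < r.
Proof.
move=> S0 Sr; apply: contrapT => H; move: Sr; rewrite ltNge => /negP; apply.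
apply: dist_set_glb => // a Sa; rewrite leNgt; apply/negP => ar.
by apply: H; exists a.
Qed.

Lemma dist_set_mem x S : S x -> dist_set x S = 0.
Proof.
move=> Sx; apply/eqP; rewrite eq_le -{1}(mdistxx x) dist_set_le//=.
by apply: dist_set_glb => [|a _]; [exists x|exact: mdist_ge0].
Qed.

Lemma dist_set_closure x S : S !=set0 -> dist_set x (closure S) = dist_set x S.
Proof.
move=> S0; have cS0 : closure S !=set0.
  by case: S0 => a Sa; exists a; exact: subset_closure.
apply/eqP; rewrite eq_le; apply/andP; split.
  by apply: dist_set_glb => // a Sa; apply: dist_set_le; exact: subset_closure.
apply: dist_set_glb => // a /closure_mdistP cSa.
apply/ler_addgt0Pr => e /cSa[b Sb ab].
have := dist_set_le x Sb; have := metric_triangle x a b; lra.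
Qed.

End dist_set.

(** Cancels the cap [j%:R^-1] once a truncated gap is known to be below [Num.min j%:R^-1 d]. *)
Lemma min_lt2l d (T : orderType d) (x y z : T) :
  (Order.min x y < Order.min x z -> y < z)%O.
Proof.
rewrite lt_min !gt_min ltxx/= => /andP[yx /orP[|//]]; exact: lt_trans.
Qed.

(** * Pointwise bounds for the Attouch-Wets distance *)

Section aw_dist.
Context {R : realType} {X : metricType R}.
Implicit Types (x : X) (A B : CL X).

Lemma aw_dist_ge_min (x0 : X) A B x (j : nat) : mdist x0 x < j%:R ->
  Num.min j%:R^-1 `|dist_set x A - dist_set x B| <= aw_dist x0 A B.
Proof.
move=> xj; have j0 : (0 < j)%N.
  by rewrite -(@ltr_nat R); apply: le_lt_trans xj; exact: mdist_ge0.
apply: le_trans (aw_dist_ge x0 A B j0); rewrite le_min ge_min lexx/=.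
rewrite ge_min; apply/orP; right; apply: ub_le_sup; last by exists x.
exists ((j%:R + dist_set x0 A) + (j%:R + dist_set x0 B)) => _ [y /= yj <-].
have := dist_set_lip y x0 A; have := dist_set_lip y x0 B.
have := dist_set_ge0 y A; have := dist_set_ge0 y B.
rewrite ler_norml (metric_sym y x0); lra.
Qed.

(* Beyond radius [j] the cap [1/k] already controls the supremum. *)
Lemma aw_dist_le_ball (x0 : X) A B (j : nat) (r : R) : (0 < j)%N -> j%:R^-1 <= r ->
  (forall x, mdist x0 x < j%:R -> `|dist_set x A - dist_set x B| <= r) ->
  aw_dist x0 A B <= r.
Proof.
move=> j0 jr H; apply: aw_dist_le => k k0; rewrite ge_min.
case: (leqP k j) => kj; apply/orP; [right|left].
  apply: ge_sup.
    by exists `|dist_set x0 A - dist_set x0 B|, x0 => //=; rewrite mdistxx ltr0n.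
  move=> _ [x /= xk <-]; apply: H; apply: lt_le_trans xk _.
  by rewrite ler_nat.
apply: le_trans jr; rewrite lef_pV2 ?posrE ?ltr0n// ler_nat; exact: ltnW.
Qed.

End aw_dist.

(* Either infinitely many [p n] (or [q n]) lie in one small ball, and these
   indices work, or every point is eventually avoided by both sequences, and a
   fast growing choice of indices works. *)
Lemma efremovich {R : realType} {Y : metricType R} (p q : nat -> Y) (e : R) :
  0 < e -> (forall n, e <= mdist (p n) (q n)) ->
  exists2 s : nat -> nat, (forall k, (k <= s k)%N) &
    forall i j, e / 4 <= mdist (p (s i)) (q (s j)).
Proof.
move=> e0 pq.
have [[c]|noP] := pselect (exists c, forall N, exists n, (N <= n)%N /\ mdist (p n) c < e / 4).
  move=> /choice[s sP]; exists s => [k|i j]; first by case: (sP k).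
  have [_ si] := sP i; have [_ sj] := sP j.
  (* The points [p (s n)] lie within [e / 2] of one another, so [p (s i)] is still more than [e / 2]
     away from [q (s j)]. *)
  have := metric_triangle (p (s j)) (p (s i)) (q (s j)).
  have := metric_triangle (p (s j)) c (p (s i)).
  have := pq (s j); rewrite (metric_sym c); lra.
have [[c]|noQ] := pselect (exists c, forall N, exists n, (N <= n)%N /\ mdist (q n) c < e / 4).
  move=> /choice[s sP]; exists s => [k|i j]; first by case: (sP k).
  have [_ si] := sP i; have [_ sj] := sP j.
  have := metric_triangle (p (s i)) (q (s j)) (q (s i)).
  have := metric_triangle (q (s j)) c (q (s i)).
  have := pq (s i); rewrite (metric_sym c); lra.
have away (u : nat -> Y) :
    ~ (exists c, forall N, exists n, (N <= n)%N /\ mdist (u n) c < e / 4) ->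
    forall c, exists N, forall n, (N <= n)%N -> e / 4 <= mdist (u n) c.
  move=> nou c; apply: contrapT => H; apply: nou; exists c => N.
  apply: contrapT => HN; apply: H; exists N => n Nn.
  by rewrite leNgt; apply/negP => un; apply: HN; exists n.
have /choice[N NP] : forall m, exists N, forall n, (N <= n)%N ->
    e / 4 <= mdist (p n) (q m) /\ e / 4 <= mdist (p m) (q n).
  move=> m; have [N1 N1P] := away p noP (q m); have [N2 N2P] := away q noQ (p m).
  exists (maxn N1 N2) => n; rewrite geq_max => /andP[/N1P ? /N2P ?].
  by split => //; rewrite metric_sym.
(* [M m] exceeds [m] and every [N i] with [i <= m], so each iterate [s j] is past the thresholds
   [N (s i)] of all earlier ones. *)
pose M m := (m.+1 + \sum_(i < m.+1) N i)%N.
have ltM m : (m < M m)%N by rewrite leq_addr.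
have NM i m : (i <= m)%N -> (N i <= M m)%N.
  move=> im; rewrite /M (bigD1 (Ordinal (im : i < m.+1)%N))//=.
  by rewrite addnCA leq_addr.
pose s k := iter k M 0%N.
have s_homo i k : (s i <= s (i + k))%N.
  by elim: k => [|k IH]; rewrite ?addn0// addnS (leq_trans IH)// ltnW// ltM.
have Ns i j : (i < j)%N -> (N (s i) <= s j)%N.
  case: j => // j; rewrite ltnS => ij; apply: NM.
  by rewrite -(subnKC ij); exact: s_homo.
exists s => [|i j]; first by elim=> // k IH; exact: leq_ltn_trans IH (ltM _).
have [/Ns/NP[]|/Ns/NP[]|->] // := ltngtP i j.
apply: le_trans (pq _); lra.
Qed.


(** * Boundedness through balls about a base point *)

Section boundedness.
Context {R : realType} {X : metricType R}.

Lemma exists_nat_gt (r : R) : exists2 j : nat, (0 < j)%N & r < j%:R.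
Proof. by exists (Num.truncn r).+1 => //; exact: truncnS_gt. Qed.

Lemma metric_boundedP (x0 : X) (B : set X) :
  metric_bounded B <-> exists j : nat, forall x, B x -> mdist x0 x < j%:R.
Proof.
split=> [[M BM]|[j Bj]]; last first.
  exists (j%:R + j%:R) => x y /Bj xj /Bj yj.
  have := metric_triangle x x0 y; rewrite (metric_sym x x0); lra.
have [[b Bb]|noB] := pselect (exists b, B b); last first.
  by exists 0%N => x Bx; case: noB; exists x.
have [j _ jP] := exists_nat_gt (mdist x0 b + M); exists j => x Bx.
have := metric_triangle x0 b x; have := BM _ _ Bb Bx; lra.
Qed.

End boundedness.

(** * Sufficiency of the two conditions *)

Section continuity.
Context {R : realType} {X Y : metricType R}.
Variables (f : X -> Y) (x0 : X) (y0 : Y).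

(** An almost nearest point [f a] to [y] lies within [r] of [y]; then some [b] in [B] is within [d]
    of [a], and [f b] is within [e] of [f a]. *)
Lemma dist_set_image_le (A B : set X) (y : Y) (d e r : R) :
  A !=set0 -> B !=set0 ->
  (forall a, A a -> mdist y (f a) < r -> dist_set a B < d) ->
  (forall a x, mdist y (f a) < r -> mdist a x < d -> mdist (f a) (f x) < e) ->
  dist_set y (f @` A) < r ->
  dist_set y (f @` B) <= dist_set y (f @` A) + e.
Proof.
move=> A0 B0 AB uc Ar; apply/ler_addgt0Pr => h h0.
have /dist_set_lt[|_ [a Aa <-]] :
    dist_set y (f @` A) < Num.min (dist_set y (f @` A) + h) r.
  by rewrite lt_min Ar ltrDl h0.
  by case: A0 => a Aa; exists (f a), a.
rewrite lt_min => /andP[ah ar].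
have [b Bb ab] := dist_set_lt B0 (AB _ Aa ar).
have := uc _ _ ar ab; have := metric_triangle y (f a) (f b).
have : dist_set y (f @` B) <= mdist y (f b) by apply: dist_set_le; exists b.
lra.
Qed.

Lemma CL_map_continuous :
  (forall r : R, unif_continuous_on f [set x | mdist y0 (f x) < r]) ->
  (forall r : R, metric_bounded [set x | mdist y0 (f x) < r]) ->
  continuous (CL_map f : AW x0 -> AW y0).
Proof.
move=> uc bd; apply/continuous_mdistP => A e e0.
have [j j0 je] := exists_nat_gt (2 / e).
have jV : j%:R^-1 <= e / 2.
  by rewrite -[e / 2]invf_div lef_pV2 ?posrE ?ltr0n// ?divr_gt0// ltW.
(* The image of [A] will be at distance at most [M] from [y]; since [e' <= 1], the image of [B] is
   then at distance at most [M + 1], so the comparison at radius [M + 2] works in both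
   directions. *)
pose e' : R := Num.min (e / 2) 1.
have [e'e e'1] : e' <= e / 2 /\ e' <= 1 by rewrite /e' !ge_min !lexx orbT.
have e'0 : 0 < e' by rewrite lt_min ltr01 divr_gt0.
have [a0 Aa0] := cl_nonempty A.
pose M := j%:R + mdist y0 (f a0).
have [d d0 dP] := uc (j%:R + (M + 2)) _ e'0.
have [n nP] := (metric_boundedP x0 _).1 (bd (j%:R + (M + 2))).
exists (Num.min n.+1%:R^-1 d) => [|B]; first by rewrite lt_min d0 invr_gt0 ltr0n.
rewrite !AW_mdistE => AB.
have close x : mdist y0 (f x) < j%:R + (M + 2) ->
    `|dist_set x (cl_set A) - dist_set x (cl_set B)| < d.
  move=> xK; have xn : mdist x0 x < n.+1%:R.
    by apply: lt_le_trans (nP _ xK) _; rewrite ler_nat.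
  have := le_lt_trans (aw_dist_ge_min A B xn) AB.
  exact: min_lt2l.
have e2 : e / 2 < e by lra.
apply: le_lt_trans e2; apply: (aw_dist_le_ball j0 jV) => y yj /=.
have inK x : mdist y (f x) < M + 2 -> mdist y0 (f x) < j%:R + (M + 2).
  by have := metric_triangle y0 y (f x); lra.
have ucy a x : mdist y (f a) < M + 2 -> mdist a x < d -> mdist (f a) (f x) < e'.
  by move=> /inK; exact: dP.
have AB' a : cl_set A a -> mdist y (f a) < M + 2 -> dist_set a (cl_set B) < d.
  by move=> Aa /inK/close; rewrite (dist_set_mem Aa) ltr_norml; lra.
have BA' b : cl_set B b -> mdist y (f b) < M + 2 -> dist_set b (cl_set A) < d.
  by move=> Bb /inK/close; rewrite (dist_set_mem Bb) ltr_norml; lra.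
have yA : dist_set y (f @` cl_set A) <= M.
  have : dist_set y (f @` cl_set A) <= mdist y (f a0) by apply: dist_set_le; exists a0.
  by have := metric_triangle y y0 (f a0); rewrite (metric_sym y y0) /M; lra.
have leA := dist_set_image_le (cl_nonempty A) (cl_nonempty B) AB' ucy.
have leB := dist_set_image_le (cl_nonempty B) (cl_nonempty A) BA' ucy.
have im0 (C : CL X) : f @` cl_set C !=set0.
  by have [c Cc] := cl_nonempty C; exists (f c), c.
rewrite !dist_set_closure// ler_norml.
have {}leA := leA ltac:(lra); have {}leB := leB ltac:(lra).
lra.
Qed.

(** * Necessity of the two conditions *)

Hypothesis f_cont : continuous f.
Hypothesis F_cont : continuous (CL_map f : AW x0 -> AW y0).

Let cl (S : set X) (S0 : S !=set0) : CL X :=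
  @MkCL X (closure S) (@closed_closure _ S)
    (let: ex_intro a Sa := S0 in ex_intro _ a (subset_closure Sa)).

(** By continuity [f] maps the closure of [S] into the closure of the image of [S], so both images
    have the same closure. *)
Let dist_set_CL_map_cl (S : set X) (S0 : S !=set0) y :
  dist_set y (CL_map f (cl S0)) = dist_set y (f @` S).
Proof.
have fS0 : f @` S !=set0 by case: S0 => a Sa; exists (f a), a.
rewrite -(dist_set_closure _ fS0) /=; congr dist_set; apply/seteqP; split.
  rewrite [X in _ `<=` X](closure_id _).1; last exact: closed_closure.
  apply: closureS => _ [b /closure_mdistP Sb <-]; apply/closure_mdistP => e e0.
  have [d d0 dP] := (continuous_mdistP f).1 f_cont b e e0.
  by have [a Sa ba] := Sb d d0; exists (f a); [exists a|exact: dP].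
by apply: closureS; apply: image_subset; exact: subset_closure.
Qed.

(* Adding to [S] a point [a] that is close to [S], or far from [x0], is a small
   perturbation of [S], so [f a] must be close to [f @` S]. *)
Lemma dist_set_image_lt (S : set X) (j : nat) (e : R) : S !=set0 -> 0 < e ->
  exists2 k : nat, (0 < k)%N & forall a, mdist y0 (f a) < j%:R ->
    (forall x, mdist x0 x < k%:R ->
       dist_set x S <= dist_set x (S `|` [set a]) + k%:R^-1) ->
    dist_set (f a) (f @` S) < e.
Proof.
move=> S0 e0.
(* Using [j.+1] keeps the cap positive even when [j = 0]. *)
have [d d0 dP] := (continuous_mdistP _).1 F_cont (cl S0) (Num.min j.+1%:R^-1 e)
  ltac:(by rewrite lt_min e0 invr_gt0 ltr0n).
have [k k0 kd] := exists_nat_gt d^-1; exists k => // a aj Sa.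
have Sa0 : (S `|` [set a]) !=set0 by exists a; right.
have kVd : k%:R^-1 < d by rewrite -[d]invrK ltf_pV2 ?posrE ?ltr0n ?invr_gt0.
have /dP : @mdist _ (AW x0) (cl S0) (cl Sa0) < d.
  apply: le_lt_trans kVd; apply: (aw_dist_le_ball k0 (lexx _)) => x xk /=.
  rewrite !dist_set_closure//.
  have := Sa x xk.
  have : dist_set x (S `|` [set a]) <= dist_set x S.
    by apply: dist_set_glb => // b Sb; apply: dist_set_le; left.
  have : 0 <= k%:R^-1 :> R by rewrite invr_ge0.
  rewrite ler_norml; lra.
rewrite AW_mdistE => lt_d.
have aj1 : mdist y0 (f a) < j.+1%:R by apply: lt_le_trans aj _; rewrite ler_nat.
have := le_lt_trans (aw_dist_ge_min (CL_map f (cl S0)) (CL_map f (cl Sa0)) aj1) lt_d.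
rewrite !dist_set_CL_map_cl [X in _ - X]dist_set_mem; last by exists a => //; right.
by rewrite subr0 => /min_lt2l; exact: le_lt_trans (ler_norm _).
Qed.

Lemma unif_continuous_on_CL_map (A : set X) :
  metric_bounded (f @` A) -> unif_continuous_on f A.
Proof.
move=> /(metric_boundedP y0)[j fAj] e e0; apply: contrapT => H.
have /choice[u uP] : forall n : nat, exists ax : X * X,
    [/\ A ax.1, mdist ax.1 ax.2 < n.+1%:R^-1 & e <= mdist (f ax.1) (f ax.2)].
  move=> n; apply: contrapT => Hn; apply: H.
  exists n.+1%:R^-1 => [|a x Aa ax]; first by rewrite invr_gt0 ltr0n.
  by rewrite ltNge; apply/negP => fax; apply: Hn; exists (a, x).
have [|s s_ge fs] := @efremovich _ _ (fun n => f (u n).1) (fun n => f (u n).2) e e0.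
  by move=> n; case: (uP n).
pose S := range (fun k => (u (s k)).2).
have S0 : S !=set0 by exists (u (s 0%N)).2, 0%N.
have fS0 : f @` S !=set0 by case: S0 => a Sa; exists (f a), a.
have e40 : 0 < e / 4 by lra.
(* As [k <= s k], the pair with index [s k] is less than [1/k] apart, so its first point is close
   enough to [S] to be added. *)
have [k k0 kP] := dist_set_image_lt j S0 e40.
have [Aa ax _] := uP (s k).
have : dist_set (f (u (s k)).1) (f @` S) < e / 4.
  apply: kP => [|x _]; first by apply: fAj; exists (u (s k)).1.
  have ax' : mdist (u (s k)).1 (u (s k)).2 <= k%:R^-1.
    apply/ltW/(lt_le_trans ax); rewrite lef_pV2 ?posrE ?ltr0n// ler_nat.
    exact: leq_trans (s_ge k) (leqnSn _).
  have kV : 0 <= k%:R^-1 :> R by rewrite invr_ge0.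
  rewrite -lerBlDr; apply: dist_set_glb => [|b [Sb|->]].
  - by case: S0 => b Sb; exists b; left.
  - by have := dist_set_le x Sb; lra.
  - have /(dist_set_le x) : S (u (s k)).2 by exists k.
    by have := metric_triangle x (u (s k)).1 (u (s k)).2; lra.
rewrite ltNge => /negP; apply; apply: dist_set_glb => //.
by move=> _ [_ [i _ <-] <-]; exact: fs.
Qed.

Lemma preimage_bounded_CL_map (B : set Y) (u v : X) : metric_bounded B ->
  f u != f v -> metric_bounded (f @^-1` B).
Proof.
move=> /(metric_boundedP y0)[j Bj] uv; pose e := mdist (f u) (f v) / 2.
have e0 : 0 < e by rewrite divr_gt0// mdist_gt0.
have near1 (w : X) : exists r : R, forall z, B (f z) -> r <= mdist x0 z ->
    mdist (f z) (f w) < e.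
  have w0 : [set w] !=set0 by exists w.
  have [k k0 kP] := dist_set_image_lt j w0 e0.
  (* For [z] this far from [x0], every [x] within [k] of [x0] is nearer to [w] than to [z], so
     adding [z] to [[set w]] does not change the distance from [x]. *)
  exists (k%:R + k%:R + mdist x0 w) => z /Bj zj rz.
  have := kP z zj; rewrite image_set1; set D := dist_set (f z) _.
  have <- : D = mdist (f z) (f w) by rewrite /D/dist_set image_set1 inf1.
  apply => x xk; rewrite /dist_set image_set1 inf1 -lerBlDr.
  have kV : 0 <= k%:R^-1 :> R by rewrite invr_ge0.
  apply: dist_set_glb => [|b [->|->]]; first by exists w; left.
    lra.
  have := metric_triangle x x0 w; have := metric_triangle x0 x z.
  rewrite (metric_sym x x0); lra.
have [ru ruP] := near1 u; have [rv rvP] := near1 v.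
have [n _ nP] := exists_nat_gt (Num.max ru rv).
apply/(metric_boundedP x0); exists n => z Bz; rewrite ltNge; apply/negP => nz.
move: nP; rewrite gt_max => /andP[run rvn].
have := ruP z Bz (le_trans (ltW run) nz); have := rvP z Bz (le_trans (ltW rvn) nz).
have := metric_triangle (f u) (f z) (f v); rewrite (metric_sym (f u) (f z)) /e; lra.
Qed.

End continuity.

Theorem theorem3p10 (R : realType) (X Y : metricType R) (f : X -> Y)
    (x0 : X) (y0 : Y) (f_cont : continuous f) :
  continuous (CL_map f : AW x0 -> AW y0) <->
  (forall A : set X, metric_bounded (f @` A) -> unif_continuous_on f A) /\
  (forall B : set Y, metric_bounded B -> ~~ (B `&` range f #<= `I_1)%card ->
     metric_bounded (f @^-1` B)).
Proof.
split=> [F_cont|[uc bd]].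
  split=> [A|B bB B2]; first exact: unif_continuous_on_CL_map.
  have [u [v /eqP uv]] : exists u v, f u <> f v.
    apply: contrapT => H; move/negP: B2; apply; apply/card_le1P.
    move=> _ _ [_ [u _ <-]] [_ [v _ <-]]; apply: contrapT => uv.
    by apply: H; exists u, v.
  exact: preimage_bounded_CL_map uv.
(* For constant [f] condition (2) is vacuous and preimages of balls may be unbounded, but the
   induced map is itself constant. *)
have [fconst|] := pselect (forall u v, f u = f v).
  apply/continuous_mdistP => A e e0; exists 1 => // B _.
  suff -> : CL_map f A = CL_map f B by rewrite mdistxx.
  apply: CL_eq => /=; congr closure.
  have [a Aa] := cl_nonempty A; have [b Bb] := cl_nonempty B.
  by apply/seteqP; split => _ [x _ <-]; [exists b|exists a].
move=> /existsNP[u /existsNP[v uv]].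
have ball_bounded (r : R) : metric_bounded [set y | mdist y0 y < r].
  have [j _ rj] := exists_nat_gt r; apply/(metric_boundedP y0); exists j => y.
  by move=> /lt_trans; exact.
apply: CL_map_continuous => r.
  apply: uc; have [M MP] := ball_bounded r; exists M.
  by move=> _ _ [x xr <-] [x' xr' <-]; exact: MP.
(* A ball of radius at least [s + 1] contains both [f u] and [f v], so (2) applies to it; smaller
   balls have smaller preimages. *)
set s := Num.max (mdist y0 (f u)) (mdist y0 (f v)).
have [us vs] : mdist y0 (f u) <= s /\ mdist y0 (f v) <= s.
  by rewrite !le_max !lexx orbT.
have [||M MP] := bd [set y | mdist y0 y < Num.max r (s + 1)]; first exact: ball_bounded.
  apply/negP => /card_le1P /(_ (f u) (f v)) H; apply: uv; apply: H; split=> /=.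
  - rewrite lt_max; apply/orP; right; lra.
  - by exists u.
  - rewrite lt_max; apply/orP; right; lra.
  - by exists v.
by exists M => x y /= xr yr; apply: MP => /=; rewrite lt_max ?xr ?yr.
Qed.
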